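(* Let $d\ge 1$ be an integer and let $A\subset \mathbb{R}^d$ be a finite set with $|A|=m$. Assume that $A$ is proper $d$-dimensional, and let $A'=\operatorname{vert} A$ be the set of vertices of $A$. Then $$|A+A'| \ge m(d+1)-\frac{d(d+1)}{2}.$$
   Context: A set in $\mathbb{R}^d$ is proper $d$-dimensional if it is not contained in any affine hyperplane. A point $a\in A$ is a vertex of a set $A\subset\mathbb{R}^d$ if it is not in the convex hull of $A\setminus\{a\}$; the set of vertices of $A$ is denoted $\operatorname{vert} A$. The sumset is $X+Y=\{x+y: x\in X,\ y\in Y\}$, and $|X|$ denotes cardinality. *)

(* Defs.v *)
From mathcomp Require Import all_boot all_order all_algebra finmap.
From mathcomp Require Import boolp classical_sets reals convex.

Set Implicit Arguments.
Unset Strict Implicit.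
Unset Printing Implicit Defensive.

Import Order.TTheory GRing.Theory Num.Theory.

Local Open Scope classical_set_scope.
Local Open Scope ring_scope.

Definition convex_hull (R : realType) (d : nat) (X : set 'rV[R]_d) :
    set 'rV[R]_d :=
  smallest (@convex_set R 'rV[R]_d) X.

Definition affine_hyperplane (R : realType) (d : nat) (H : set 'rV[R]_d) :
    Prop :=
  exists (u : 'rV[R]_d) (c : R),
    u != 0 /\ H = [set x | \sum_(i < d) u 0 i * x 0 i = c].

Definition proper_dimensional (R : realType) (d : nat) (A : set 'rV[R]_d) :
    Prop :=
  forall H : set 'rV[R]_d, affine_hyperplane H -> ~ (A `<=` H).

Definition vert (R : realType) (d : nat) (A : {fset 'rV[R]_d}) :
    {fset 'rV[R]_d} :=
  [fset a in A | a \notin convex_hull ([set` A] `\ a)%classic]%fset.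

Definition sumset (R : realType) (d : nat) (X Y : {fset 'rV[R]_d}) :
    {fset 'rV[R]_d} :=
  [fset (x + y)%R | x in X, y in Y]%fset.

(* Main.v *)
(** Order the points [b_1, ..., b_n] of a minimal [S] inside [vert A] with
    [A] in [conv S] so that the first [d+1] are affinely independent, and
    triangulate [conv S] by giving every point its representation as a convex
    combination that uses the late [b_i] as little as possible.  If [F] is the
    carrier of [a] and [F + b] is a face, the carrier of [(a + b)/2] is [F + b],
    so all these sums [a + b] are distinct, except that [b_i + b_j] arises twice
    for an edge.  Every face extends to one with [d+1] points, which gives
    [d+1] sums for each [a] not in [S]; for [a = b_k] take only [b_j] with
    [j <= k], which counts each edge once: the faces inside a prefix triangulate
    its hull, so this gives [min(k, d+1)] sums.  The total deficit is
    [d + (d-1) + ... + 1].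

    Points are homogenized to [(1, x)], turning convex combinations into conic
    ones. *)
Require Import Defs.
From mathcomp Require Import all_boot all_order all_algebra finmap.
From mathcomp Require Import boolp classical_sets reals convex interval_inference.
From mathcomp Require Import lra zify.

Set Implicit Arguments.
Unset Strict Implicit.
Unset Printing Implicit Defensive.

Import Order.TTheory GRing.Theory Num.Theory.
Local Open Scope ring_scope.

(** * Nonnegative coefficient vectors and arbitrarily small parameters *)

Definition nonneg_vec (R : realType) n (l : 'rV[R]_n) := forall i, 0 <= l 0 i.

Definition supp_in (R : realType) n (l : 'rV[R]_n) (F : {set 'I_n}) :=
  forall i, i \notin F -> l 0 i = 0.

(** Wherever [u] is negative, [l] is positive, so the least of the finitely many ratios
    [l 0 i / - u 0 i] bounds the step. *)
Lemma small_step (R : realType) n (l u : 'rV[R]_n) :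
  nonneg_vec l -> (forall i, l 0 i = 0 -> 0 <= u 0 i) ->
  exists2 e, 0 < e & nonneg_vec (l + e *: u).
Proof.
move=> l0 u0.
pose f i := if u 0 i < 0 then l 0 i / - u 0 i else 1.
exists (\big[Num.min/1]_i f i).
  apply: (big_ind (fun x : R => 0 < x)) => // [x y x0 y0|i _].
    by rewrite lt_min x0.
  rewrite /f; case: (ltP (u 0 i) 0) => // ui; apply: divr_gt0; last by rewrite oppr_gt0.
  rewrite lt_neqAle l0 andbT eq_sym; apply/eqP => /u0.
  by rewrite leNgt ui.
have e0 : 0 <= \big[Num.min/1]_i f i.
  apply: (big_ind (fun x : R => 0 <= x)) => // [x y x0 y0|i _].
    by rewrite le_min x0.
  rewrite /f; case: (ltP (u 0 i) 0) => // ui; apply: divr_ge0; first exact: l0.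
  by rewrite oppr_ge0 ltW.
move=> i; rewrite !mxE.
have [ui|ui] := ltP (u 0 i) 0; last by apply: addr_ge0 => //; apply: mulr_ge0.
have : \big[Num.min/1]_i f i <= f i by apply: bigmin_le_cond.
rewrite /f ui ler_pdivlMr ?oppr_gt0 // mulrN => H.
by rewrite -[X in _ + X]opprK subr_ge0.
Qed.

(** Otherwise each [i] has a threshold below which [P i] fails, and the least threshold contradicts
    the hypothesis. It selects a single face that serves arbitrarily small parameters. *)
Lemma pigeonhole_small (R : realType) (I : finType) (P : I -> R -> Prop) :
  (forall e, 0 < e -> exists i s, s < e /\ P i s) ->
  exists i, forall e, 0 < e -> exists s, s < e /\ P i s.
Proof.
move=> H; apply: contrapT => /forallNP H1.
have [e He] : exists e : I -> R, forall i, 0 < e i /\ forall s, s < e i -> ~ P i s.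
  suff /choice [e He] : forall i, exists e : R, 0 < e /\ forall s, s < e -> ~ P i s.
    by exists e.
  move=> i; apply: contrapT => /forallNP H2; apply: (H1 i) => e e0.
  apply: contrapT => /forallNP H3; apply: (H2 e); split=> // s se Ps.
  by apply: (H3 s).
have [|i [s [se Ps]]] := H (\big[Num.min/1]_i e i).
  apply: (big_ind (fun x : R => 0 < x)) => // [x y x0 y0|i _].
    by rewrite lt_min x0.
  by case: (He i).
have [_ /(_ s)] := He i; apply=> //; apply: lt_le_trans se _.
exact: bigmin_le_cond.
Qed.

(** * The placing triangulation: faces, carriers and stars *)

Section Faces.

Variables (R : realType) (n N : nat) (M : 'M[R]_(n, N)) (h : 'I_n -> nat).
Hypothesis h_inj : injective h.

(** [u] is zero, or its nonzero entry that comes last in the order [h] is positive. *)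
Definition lex_nonneg (u : 'rV[R]_n) :=
  forall k, (forall j, (h k < h j)%N -> u 0 j = 0) -> 0 <= u 0 k.

(** Equivalently: every nonnegative combination supported on [F] is the
    lexicographically least one representing its value, later indices being
    compared first.  A perturbation [u] that stays nonnegative off [F] is
    therefore not allowed to decrease it. *)
Definition face (F : {set 'I_n}) := forall u : 'rV[R]_n,
  u *m M = 0 -> (forall i, i \notin F -> 0 <= u 0 i) -> lex_nonneg u.

Definition prefix_set k : {set 'I_n} := [set i | h i < k]%N%SET.

Definition in_cone (F : {set 'I_n}) x :=
  exists l, [/\ nonneg_vec l, supp_in l F & l *m M = x].

(** Descending induction along [h]: once all later entries vanish, both signs apply to the current
    one. *)
Lemma lex_nonneg_anti u : lex_nonneg u -> lex_nonneg (- u) -> u = 0.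
Proof.
move=> u0 uN0; apply/rowP => i; rewrite mxE.
have hM j : (h j <= \max_k h k)%N by exact: leq_bigmax.
have [p] := ubnP (\max_k h k - h i)%N.
elim: p i => // p IH i ip.
have Hz j : (h i < h j)%N -> u 0 j = 0.
  by move=> ij; apply: IH; have := hM j; have := hM i; lia.
apply/eqP; rewrite eq_le u0 // andbT -oppr_ge0.
have := uN0 i; rewrite mxE; apply => j /Hz; rewrite mxE => ->.
by rewrite oppr0.
Qed.

Lemma face_sub (F G : {set 'I_n}) : F \subset G -> face G -> face F.
Proof.
move=> FG fG u uM uF; apply: fG => // i iG; apply: uF.
by apply: contraNN iG; apply: (fintype.subsetP FG).
Qed.

(** Both [u] and [- u] vanish off [F], so both are lexicographically nonnegative. Faces are thus
    simplicial: their rows are linearly independent. *)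
Lemma face_free F u : face F -> u *m M = 0 -> supp_in u F -> u = 0.
Proof.
move=> fF uM uF; apply: lex_nonneg_anti; apply: fF => //.
- by move=> i /uF ->.
- by rewrite mulNmx uM oppr0.
- by move=> i /uF; rewrite mxE => ->; rewrite oppr0.
Qed.

(** The difference [l - l'] is nonnegative off [G] and its opposite is nonnegative off [F]. Hence
    the carrier of a point is well defined. *)
Lemma face_unique F G l l' : face F -> face G ->
  nonneg_vec l -> nonneg_vec l' -> supp_in l F -> supp_in l' G ->
  l *m M = l' *m M -> l = l'.
Proof.
move=> fF fG l0 l'0 lF l'G e; apply/eqP; rewrite -subr_eq0; apply/eqP.
apply: lex_nonneg_anti.
- apply: fG; first by rewrite mulmxBl e subrr.
  by move=> i /l'G e'; rewrite !mxE e' subr0.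
- rewrite opprB; apply: fF; first by rewrite mulmxBl e subrr.
  by move=> i /lF e'; rewrite !mxE e' subr0.
Qed.

(** As [F] is free, the coefficients of [x + s y] are affine in [s], so their
    nonnegativity passes to [s = 0]. *)
Lemma cone_ray F x y : face F ->
  (forall e, 0 < e -> exists s, s < e /\ (0 <= s /\ in_cone F (x + s *: y))) ->
  in_cone F x.
Proof.
move=> fF H; apply: contrapT => nx.
have pos s : 0 <= s -> in_cone F (x + s *: y) -> 0 < s.
  rewrite le_eqVlt => /orP[/eqP <-|//]; by rewrite scale0r addr0 => /nx.
have [s1 [_ [s10 c1]]] := H 1 ltr01.
have s1p := pos _ s10 c1.
have [s2 [s21 [s20 c2]]] := H s1 s1p.
case: c1 => l1 [_ l1F e1]; case: c2 => l2 [_ l2F e2].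
(* The coefficient vector is affine in [s]: [c] is its slope and [l0] its value at [s = 0], read off
   from two parameters. *)
pose c := (s1 - s2)^-1 *: (l1 - l2); pose l0 := l1 - s1 *: c.
have s12 : s1 - s2 != 0 by rewrite subr_eq0 gt_eqF.
have cM : c *m M = y.
  rewrite -scalemxAl mulmxBl e1 e2 opprD addrACA subrr add0r -scalerBl.
  by rewrite scalerA mulVf // scale1r.
have l0M : l0 *m M = x by rewrite mulmxBl e1 -scalemxAl cM addrK.
have cF : supp_in c F by move=> i iF; rewrite !mxE l1F // l2F // subrr mulr0.
have l0F : supp_in l0 F by move=> i iF; rewrite !mxE l1F // l2F // subrr !mulr0 subrr.
have Hl s l : supp_in l F -> l *m M = x + s *: y -> l = l0 + s *: c.
  move=> lF lM; apply/eqP; rewrite -subr_eq0; apply/eqP.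
  apply: (face_free fF).
    by rewrite mulmxBl lM mulmxDl l0M -scalemxAl cM subrr.
  move=> i iF; rewrite mxE (lF i iF) !mxE.
  by have := l0F i iF; have := cF i iF; rewrite !mxE => -> ->; rewrite mulr0 addr0 subr0.
apply: nx; exists l0; split=> // i; rewrite leNgt; apply/negP => li.
(* If [l0 0 i] is negative, any smaller [s] than this threshold keeps entry [i] of [l0 + s *: c]
   negative; the added 1 keeps the denominator positive. *)
have d0 : 0 < `|c 0 i| + 1 by rewrite ltr_wpDl.
have [] := H (- l0 0 i / (`|c 0 i| + 1)); first by rewrite divr_gt0 // oppr_gt0.
move=> s [se [s0 [l [l_ge0 lF lM]]]].
have := l_ge0 i; rewrite (Hl s l lF lM) mxE [X in _ + X]mxE.
move: se; rewrite ltr_pdivlMr // => se Hi.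
have : s * c 0 i <= s * `|c 0 i| by rewrite ler_wpM2l // ler_norm.
move: se; rewrite mulrDr mulr1 => se H2.
have : l0 0 i + s * c 0 i < 0 by lra.
by rewrite ltNge Hi.
Qed.

Lemma mem_prefix_set k i : (i \in prefix_set k) = (h i < k)%N.
Proof. by rewrite inE. Qed.

(** Induction on the prefix: split off the last generator with its least coefficient. The remainder
    lies in a face by induction, and the support of the combined representation is again a face. *)
Lemma in_cone_face_prefix k x : in_cone (prefix_set k) x ->
  exists F, [/\ face F, F \subset prefix_set k & in_cone F x].
Proof.
elim: k x => [|k IH] x [l [l0 lk lM]].
  exists (prefix_set 0); split=> //; last by exists l.
  by move=> u _ u0 i _; apply: u0; rewrite mem_prefix_set.
have prefS : prefix_set k \subset prefix_set k.+1.
  by apply/fintype.subsetP => i; rewrite !mem_prefix_set; lia.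
have [[i0 hi0]|nk] := EM (exists i, h i = k); last first.
  have [|F [fF Fk cF]] := IH x.
    exists l; split=> // i; rewrite mem_prefix_set => ik; apply: lk.
    rewrite mem_prefix_set; apply/negP => ik1; apply: nk; exists i; lia.
  by exists F; split=> //; apply: fintype.subset_trans prefS.
set b := row i0 M.
have dE : delta_mx 0 i0 *m M = b by rewrite [b]rowE.
pose T := [set t : R | 0 <= t /\ in_cone (prefix_set k) (x - t *: b)]%classic.
have TI : has_inf T.
  split; last by exists 0 => t [].
  exists (l 0 i0); split; first exact: l0.
  exists (l - l 0 i0 *: delta_mx 0 i0); split.
  - move=> i; rewrite !mxE eqxx /=; case: eqVneq => [->|_].
      by rewrite mulr1 subrr.
    by rewrite mulr0 subr0.
  - move=> i; rewrite mem_prefix_set !mxE eqxx /= => ik; case: eqVneq => [->|ne].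
      by rewrite mulr1 subrr.
    rewrite mulr0 subr0 lk // mem_prefix_set; apply: contra_neqN ne => ik1.
    by apply: h_inj; lia.
  - by rewrite mulmxBl lM -scalemxAl dE.
(* The placing step: use [row i0 M] with the least possible coefficient. *)
set t := inf T.
have t0 : 0 <= t by apply: lb_le_inf; [case: TI|move=> y []].
(* Coefficients arbitrarily close to [t] leave remainders in one and the same face, so [cone_ray]
   shows that the infimum is attained. *)
have [F HF] : exists F : {set 'I_n}, forall e, 0 < e -> exists s, s < e /\
    (0 <= s /\ (face F /\ F \subset prefix_set k /\
      in_cone F ((x - t *: b) + s *: - b))).
  apply: pigeonhole_small => e e0.
  have [t1 Tt1 t1t] := inf_adherent e0 TI.
  have tt1 : t <= t1 by apply: ge_inf => //; case: TI.
  have [_ /IH [F [fF Fk cF]]] := Tt1.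
  exists F, (t1 - t); split; first by rewrite ltrBlDl.
  split; first by rewrite subr_ge0.
  split=> //; split=> //; congr (in_cone F _): cF.
  by rewrite scalerN -addrA -opprD -scalerDl [t + _]addrC subrK.
have [_ [_ [_ [fF [Fk _]]]]] := HF 1 ltr01.
have [|l1 [l10 l1F l1M]] := cone_ray (x := x - t *: b) (y := - b) fF.
  by move=> e /HF [s [se [s0 [_ [_ c]]]]]; exists s.
have l1k i : (k <= h i)%N -> l1 0 i = 0.
  move=> ki; apply: l1F; apply/negP => /(fintype.subsetP Fk).
  by rewrite mem_prefix_set; lia.
pose l2 := l1 + t *: delta_mx 0 i0.
have l2E i : i != i0 -> l2 0 i = l1 0 i.
  by move=> ne; rewrite !mxE (negPf ne) andbF mulr0 addr0.
have l2i0 : l2 0 i0 = t by rewrite !mxE !eqxx mulr1 l1k ?add0r // hi0.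
have l2M : l2 *m M = x by rewrite mulmxDl l1M -scalemxAl dE subrK.
have l20 : nonneg_vec l2.
  by move=> i; have [->|/l2E ->] := eqVneq i i0; rewrite ?l2i0.
have l2k i : (k < h i)%N -> l2 0 i = 0.
  by move=> ki; rewrite l2E ?l1k 1?ltnW //; apply/eqP => e; move: ki; rewrite e hi0 ltnn.
exists [set i | l2 0 i != 0]%SET; split; last first.
- by exists l2; split=> // i; rewrite inE negbK => /eqP.
- apply/fintype.subsetP => i; rewrite inE mem_prefix_set; apply: contraNT.
  by rewrite -leqNgt => /l2k ->.
move=> u uM u0 j uj.
have {}u0 i : l2 0 i = 0 -> 0 <= u 0 i by move=> e; apply: u0; rewrite inE negbK e.
(* After [k], [l2] vanishes; before [k], the face [F] applies; at [k] itself the minimality of [t]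
   decides. *)
have [kj|jk|jk] := ltngtP k (h j).
- by apply: u0; apply: l2k.
- apply: (fF u uM) => // i iF; have [->|/l2E e] := eqVneq i i0.
    by rewrite uj // hi0.
  by apply: u0; rewrite e l1F.
have {}jk : j = i0 by apply: h_inj; rewrite hi0.
rewrite leNgt; apply/negP => uj0; subst j.
have [e e0 H] := small_step l20 u0.
have dne c i : i != i0 -> (c *: delta_mx 0 i0 : 'rV[R]_n) 0 i = 0.
  by move=> ne; rewrite !mxE (negPf ne) andbF mulr0.
(* A negative [u 0 i0] would make [l2 + e *: u] a representation of [x] whose coefficient at [i0] is
   below [t]. *)
have : t <= t + e * u 0 i0.
  apply: ge_inf; first by case: TI.
  split; first by have := H i0; rewrite mxE l2i0 mxE.
  exists (l2 + e *: u - (t + e * u 0 i0) *: delta_mx 0 i0); split.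
  - move=> i; have [->|ne] := eqVneq i i0.
      by rewrite 2!mxE l2i0 !mxE !eqxx mulr1 subrr.
    by rewrite mxE [X in _ + X]mxE dne // oppr0 addr0.
  - move=> i; rewrite mem_prefix_set -leqNgt => ki.
    have [->|ne] := eqVneq i i0.
      by rewrite 2!mxE l2i0 !mxE !eqxx mulr1 subrr.
    have {}ki : (k < h i)%N.
      by rewrite ltn_neqAle ki andbT -hi0; apply: contra_neq ne => /h_inj.
    rewrite 2!mxE l2k // !mxE (negPf ne) andbF mulr0 uj ?hi0 //.
    by rewrite mulr0 addr0 subr0.
  - by rewrite mulmxBl mulmxDl l2M -!scalemxAl uM dE scaler0 addr0.
by rewrite lerDl pmulr_rge0 // leNgt uj0.
Qed.

(** Zeroing rows instead of deleting them keeps the shape fixed, so the spans for different [F]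
    compare directly. *)
Definition mask_rows (F : {set 'I_n}) : 'M[R]_(n, N) :=
  \matrix_i (if i \in F then row i M else 0).

Lemma row_mask_rows F i : row i (mask_rows F) = if i \in F then row i M else 0.
Proof. by rewrite rowK. Qed.

Lemma rank_mask_rows F : (\rank (mask_rows F) <= #|F|)%N.
Proof.
apply: leq_trans (rank_leq_row (rowsub (@enum_val _ (mem F)) M)); apply: mxrankS.
apply/row_subP => i; rewrite row_mask_rows; case: ifP => iF; last exact: sub0mx.
have -> : row i M = row (enum_rank_in iF i) (rowsub (@enum_val _ (mem F)) M).
  by apply/rowP => j; rewrite !mxE enum_rankK_in.
exact: row_sub.
Qed.

Lemma mask_rowsS (F G : {set 'I_n}) : F \subset G -> (mask_rows F <= mask_rows G)%MS.
Proof.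
move=> FG; apply/row_subP => i; rewrite row_mask_rows; case: ifP => iF; last exact: sub0mx.
have -> : row i M = row i (mask_rows G) by rewrite row_mask_rows (fintype.subsetP FG).
exact: row_sub.
Qed.

Lemma in_cone_mask_rows F x : in_cone F x -> (x <= mask_rows F)%MS.
Proof.
move=> [l [_ lF <-]]; have -> : l *m M = l *m mask_rows F.
  rewrite !mulmx_sum_row; apply: eq_bigr => i _; rewrite row_mask_rows.
  by case: ifPn => // /lF ->; rewrite !scale0r.
exact: submxMl.
Qed.

(** Purity of the triangulation: [G] is taken maximal among the faces inside the prefix, and then
    spans it. *)
Lemma face_star k F : face F -> F \subset prefix_set k ->
  exists G, [/\ face G, F \subset G, G \subset prefix_set k &
    (\rank (mask_rows (prefix_set k)) <= #|G|)%N].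
Proof.
move=> fF Fk.
pose P (G : {set 'I_n}) := `[< face G >] && (G \subset prefix_set k).
have [|G /maxsetP[/andP[/asboolP fG Gk] Gmax] FG] := @maxset_exists _ P F.
  by rewrite /P Fk andbT; apply/asboolP.
exists G; split=> //; apply: leq_trans (rank_mask_rows G); apply: mxrankS.
apply/row_subP => i; rewrite row_mask_rows; case: ifP => ik; last exact: sub0mx.
(* Moving from an interior point of the maximal face G towards row i leads into
   faces containing G, hence into G itself: row i is in the span of G. *)
pose g : 'rV[R]_n := \row_j (j \in G)%:R.
have g0 : nonneg_vec g by move=> j; rewrite mxE.
have gG : supp_in g G by move=> j /negPf jG; rewrite mxE jG.
have [G' HG'] : exists G' : {set 'I_n}, forall e, 0 < e -> exists s, s < e /\
    (0 < s /\ (face G' /\ G' \subset prefix_set k /\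
      in_cone G' (g *m M + s *: row i M))).
  apply: pigeonhole_small => e e0.
  have [|G' [fG' G'k cG']] := @in_cone_face_prefix k (g *m M + (e / 2) *: row i M).
    exists (g + (e / 2) *: delta_mx 0 i); split.
    - move=> j; rewrite mxE addr_ge0 //= !mxE mulr_ge0 //; first by rewrite divr_ge0 // ltW.
    - move=> j jk; rewrite mxE gG ?add0r; last first.
        by apply: contraNN jk; apply: (fintype.subsetP Gk).
      rewrite !mxE eqxx /=; case: eqVneq jk => [->|_ _]; first by rewrite ik.
      by rewrite mulr0.
    - by rewrite mulmxDl -scalemxAl -rowE.
  by exists G', (e / 2); split; [lra|split=> //; lra].
have [s [_ [s0 [fG' [G'k sG']]]]] := HG' 1 ltr01.
have [|l [l0 lG' lM]] := cone_ray (x := g *m M) (y := row i M) fG'.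
  move=> e /HG' [s' [s'e [s'0 [_ [_ c]]]]]; exists s'; split=> //; split=> //.
  exact: ltW.
have E : l = g by apply: (face_unique fG' fG).
have GG' : G \subset G'.
  apply/fintype.subsetP => j jG; apply: contraT => /lG' /eqP.
  by rewrite E mxE jG oner_eq0.
have G'G : G' = G by apply: Gmax => //; rewrite /P G'k andbT; apply/asboolP.
rewrite G'G in sG'.
have -> : row i M = s^-1 *: (g *m M + s *: row i M - g *m M).
  by rewrite addrC addKr scalerA mulVf ?scale1r // gt_eqF.
apply: scalemx_sub; apply: addmx_sub; first exact: in_cone_mask_rows.
rewrite eqmx_opp; apply: in_cone_mask_rows; by exists g.
Qed.

End Faces.

(** * Homogenized points and distinct sums along stars *)

Section Homogenization.

Variables (R : realType) (d m : nat) (c : 'I_m -> 'rV[R]_d).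

Definition homog (x : 'rV[R]_d) : 'rV[R]_(1 + d) := row_mx 1%:M x.

Definition homog_mx : 'M[R]_(m, 1 + d) := row_mx (const_mx 1) (\matrix_i c i).

Lemma row_homog_mx i : row i homog_mx = homog (c i).
Proof.
rewrite row_row_mx row_const rowK; congr row_mx.
by apply/rowP => j; rewrite ord1 !mxE eqxx.
Qed.

Lemma homog_inj : injective homog.
Proof. by move=> x y /eq_row_mx[]. Qed.

Lemma mulmx_homog_mx l :
  l *m homog_mx = row_mx (\sum_i l 0 i)%:M (\sum_i l 0 i *: c i).
Proof.
rewrite mul_mx_row; congr row_mx.
  by apply/rowP => j; rewrite ord1 !mxE; apply: eq_bigr => i _; rewrite mxE mulr1.
by rewrite mulmx_sum_row; apply: eq_bigr => i _; rewrite rowK.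
Qed.

Lemma homog_weight l x : l *m homog_mx = homog x -> \sum_i l 0 i = 1.
Proof.
rewrite mulmx_homog_mx => /eq_row_mx[/matrixP/(_ 0 0)].
by rewrite !mxE eqxx !mulr1n.
Qed.

Lemma nonneg_weight1 (l : 'rV[R]_m) k : nonneg_vec l -> \sum_i l 0 i = 1 ->
  1 <= l 0 k -> l = delta_mx 0 k.
Proof.
move=> l0 l1 lk; have lk0 i : i != k -> l 0 i = 0.
  move=> ik; apply/eqP; rewrite eq_le l0 andbT.
  move: l1; rewrite (bigD1 k) //= (bigD1 i) //= => l1.
  have : 0 <= \sum_(j < m | (j != k) && (j != i)) l 0 j by apply: sumr_ge0.
  lra.
apply/rowP => i; rewrite mxE eqxx /=; have [->|/lk0 //] := eqVneq i k.
by move: l1; rewrite (bigD1 k) //= big1 ?addr0.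
Qed.

(** [G a] is a face containing the carrier of [c a], so [l + delta_mx 0 i] represents [c a + c i] on
    a face, and equal sums have equal representations. As [h] counts from 0, the last condition says
    that [G a] has at least min([h a] + 1, d + 1) elements. *)
Lemma star_system (h : 'I_m -> nat) n (S := prefix_set h n) :
  injective c -> injective h ->
  (forall a, in_cone homog_mx S (homog (c a))) ->
  (forall k, k \in S -> forall l, nonneg_vec l -> supp_in l S ->
    l *m homog_mx = homog (c k) -> l = delta_mx 0 k) ->
  (d < \rank (mask_rows homog_mx (prefix_set h d.+1)))%N ->
  prefix_set h d.+1 \subset S ->
  exists G : 'I_m -> {set 'I_m}, [/\ forall a, G a \subset S,
    forall a i a' i', i \in G a -> i' \in G a' ->
      c a + c i = c a' + c i' -> a = a' /\ i = i' &
    forall a, (d < #|G a| + (d - h a))%N].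
Proof.
move=> c_inj h_inj Scone Sext dr dS.
have rankS (F : {set 'I_m}) : prefix_set h d.+1 \subset F ->
    (d < \rank (mask_rows homog_mx F))%N.
  by move=> dF; apply: leq_trans dr _; apply/mxrankS/mask_rowsS.
(* Dropping the indices of [Q] from the first d + 1 lowers the rank by at most their number. *)
have rank_prefix k : (d < \rank (mask_rows homog_mx (prefix_set h k)) + (d.+1 - k))%N.
  pose Q : {set 'I_m} := [set i | k <= h i < d.+1]%N%SET.
  have Qc : (#|Q| <= d.+1 - k)%N.
    rewrite cardE -(size_map h) -(size_iota k (d.+1 - k)); apply: uniq_leq_size.
      by rewrite map_inj_uniq // enum_uniq.
    move=> x /mapP[i]; rewrite mem_enum inE => ? ->; rewrite mem_iota; lia.
  apply: leq_trans (leq_add (leqnn _) Qc).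
  apply: leq_trans (leq_add (leqnn _) (rank_mask_rows homog_mx Q)).
  apply: leq_trans (mxrank_adds_leqif _ _).
  apply: leq_trans dr _; apply/mxrankS/row_subP => i.
  rewrite row_mask_rows mem_prefix_set; case: ifP => id; last exact: sub0mx.
  have [ik|ki] := ltnP (h i) k.
    apply: submx_trans (addsmxSl _ _).
    have -> : row i homog_mx = row i (mask_rows homog_mx (prefix_set h k)).
      by rewrite row_mask_rows mem_prefix_set ik.
    exact: row_sub.
  apply: submx_trans (addsmxSr _ _).
  have -> : row i homog_mx = row i (mask_rows homog_mx Q).
    by rewrite row_mask_rows inE ki id.
  exact: row_sub.
have /choice[G HG] : forall a, exists G : {set 'I_m}, exists l,
    [/\ nonneg_vec l, supp_in l G, l *m homog_mx = homog (c a) & 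
    [/\ face homog_mx h G, G \subset S, (d < #|G| + (d - h a))%N
      & a \in S -> forall i, i \in G -> (h i <= h a)%N]].
  move=> a; have [F [fF FS [l [l0 lF lM]]]] := in_cone_face_prefix h_inj (Scone a).
  have [aS|aS] := boolP (a \in S); last first.
    have [G [fG FG GS rG]] := face_star h_inj fF FS.
    exists G, l; split=> //.
      by move=> i iG; apply: lF; apply: contraNN iG; apply: (fintype.subsetP FG).
    split=> //.
    apply: leq_trans (leq_addr _ _); apply: leq_trans rG; exact: rankS.
  (* Extremality leaves [a] as the whole carrier of [c a], so the singleton of [a] is a face. *)
  have lE : l = delta_mx 0 a.
    apply: Sext => // i iS; apply: lF.
    by apply: contraNN iS; apply: (fintype.subsetP FS).
  have aF : [set a]%SET \subset F.
    rewrite finset.sub1set; apply: contraT => /lF; rewrite lE mxE !eqxx => /eqP.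
    by rewrite oner_eq0.
  (* The prefix ends with [a] itself; sums with later points of [S] are left to those points. *)
  have [|G [fG FG Ga rG]] := face_star h_inj (k := (h a).+1) (face_sub aF fF).
    by rewrite finset.sub1set mem_prefix_set.
  exists G, l; split=> //.
    move=> i iG; rewrite lE mxE eqxx /=; case: eqVneq iG => [->|] //.
    by rewrite -finset.sub1set FG.
  split=> //.
  - apply/fintype.subsetP => i /(fintype.subsetP Ga); move: aS.
    rewrite !mem_prefix_set; lia.
  - by have := rank_prefix (h a).+1; move: rG; lia.
  - by move=> _ i /(fintype.subsetP Ga); rewrite mem_prefix_set.
exists G; split=> [a|a i a' i' iG i'G' e|a]; last 1 first.
- by have [l [_ _ _ []]] := HG a.
- by have [l [_ _ _ []]] := HG a.
have [l [l0 lG lM [fG GS _ Gh]]] := HG a.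
have [l' [l'0 l'G' l'M [fG' G'S _ G'h]]] := HG a'.
have nonneg_delta j : nonneg_vec (delta_mx 0 j : 'rV[R]_m).
  by move=> p; rewrite mxE.
have E : l + delta_mx 0 i = l' + delta_mx 0 i'.
  apply: (face_unique fG fG').
  - by move=> p; rewrite mxE addr_ge0 // nonneg_delta.
  - by move=> p; rewrite mxE addr_ge0 // nonneg_delta.
  - move=> p pG; rewrite mxE lG // mxE eqxx add0r /=; case: eqVneq pG => [->|] //; by rewrite iG.
  - move=> p pG; rewrite mxE l'G' // mxE eqxx add0r /=; case: eqVneq pG => [->|] //; by rewrite i'G'.
  - rewrite !mulmxDl lM l'M -!rowE !row_homog_mx /homog.
    by rewrite !add_row_mx e.
have [ii'|ii'] := eqVneq i i'.
  split=> //; apply/c_inj/homog_inj; rewrite -lM -l'M; congr (_ *m _).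
  by move: E; rewrite ii' => /addIr.
(* For [i] and [i'] distinct, [l] has weight at least 1 at [i'], hence all its weight there, and
   likewise [l'] at [i]: the two sums are one edge read in both directions. *)
have la : l = delta_mx 0 i'.
  apply: nonneg_weight1 => //; first exact: homog_weight lM.
  move/rowP/(_ i'): E; rewrite !mxE !eqxx [i' == i]eq_sym (negPf ii') /= addr0 => ->.
  by rewrite lerDr.
have l'a' : l' = delta_mx 0 i.
  apply: nonneg_weight1 => //; first exact: homog_weight l'M.
  move/rowP/(_ i): E; rewrite !mxE !eqxx (negPf ii') /= addr0 => <-.
  by rewrite lerDr.
have ai' : a = i'.
  by apply/c_inj/homog_inj; rewrite -lM la -rowE row_homog_mx.
have a'i : a' = i.
  by apply/c_inj/homog_inj; rewrite -l'M l'a' -rowE row_homog_mx.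
(* Both ends lie in [S], where [G] only looks backwards in the order, so neither end comes strictly
   first. *)
subst a a'; have ii : (h i <= h i')%N by apply: Gh => //; apply: (fintype.subsetP G'S).
have i'i : (h i' <= h i)%N by apply: G'h => //; apply: (fintype.subsetP GS).
by have ie : i = i' by apply: h_inj; lia.
Qed.

End Homogenization.

(** * Counting the sums; inequalities are doubled to avoid division *)

Lemma sum_subn_le d m : ((\sum_(k < m) (d - k)) * 2 <= d * d.+1)%N.
Proof.
elim: d m => [|d IH] [|m]; rewrite ?big_ord0 // big_ord_recl.
  by rewrite big1 // => i _; rewrite sub0n.
rewrite (eq_bigr (fun i : 'I_m => (d - i)%N)); last by move=> i _ /=; rewrite subSS.
move: (IH m); move: (\sum_(i < m) (d - i))%N => s; rewrite subn0; nia.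
Qed.

Lemma sum_subn_index_le d m (t : seq 'I_m) : uniq t -> (forall i, i \in t) ->
  ((\sum_i (d - index i t)) * 2 <= d * d.+1)%N.
Proof.
move=> ut ft; case: m t ut ft => [|m] t ut ft; first by rewrite big_ord0.
suff -> : (\sum_i (d - index i t) = \sum_(k < size t) (d - k))%N.
  exact: sum_subn_le.
rewrite -big_enum /= (perm_big t) /=; last first.
  by apply: uniq_perm => //; [exact: enum_uniq|move=> i; rewrite mem_enum ft].
rewrite (big_nth ord0) big_mkord; apply: eq_bigr => i _.
by rewrite index_uniq.
Qed.

(** The pairs ([a], [i]) with [i] in [G a] inject into [X], and their number falls short of m(d + 1)
    by at most the sum of the truncated differences [d - index a t]. *)
Lemma card_star_sums (R : realType) d m (c : 'I_m -> 'rV[R]_d) (t : seq 'I_m)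
    (G : 'I_m -> {set 'I_m}) (X : {fset 'rV[R]_d}) :
  uniq t -> (forall i, i \in t) ->
  (forall a i a' i', i \in G a -> i' \in G a' ->
      c a + c i = c a' + c i' -> a = a' /\ i = i') ->
  (forall a, (d < #|G a| + (d - index a t))%N) ->
  (forall a i, i \in G a -> c a + c i \in X) ->
  (m * d.+1 * 2 <= #|` X|%fset * 2 + d * d.+1)%N.
Proof.
move=> ut ft Ginj Gc GX.
have GXc : (\sum_a #|G a| <= #|` X|%fset)%N.
  pose Q : {set 'I_m * 'I_m} := [set p | p.2 \in G p.1]%SET.
  have -> : (\sum_a #|G a| = #|Q|)%N.
    rewrite -sum1_card (eq_bigr (fun a => \sum_(i in G a) 1)%N); last first.
      by move=> a _; rewrite sum1_card.
    by rewrite pair_big_dep /=; apply: eq_bigl => p; rewrite inE.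
  rewrite cardE -(size_map (fun p => c p.1 + c p.2)); apply: uniq_leq_size.
    rewrite map_inj_in_uniq ?enum_uniq // => -[a i] [a' i'].
    by rewrite !mem_enum !inE /= => ? ? e; have [] := Ginj a i a' i' => // -> ->.
  by move=> x /mapP[[a i]]; rewrite mem_enum inE /= => ? ->; apply: GX.
have : (\sum_(a < m) d.+1 <= \sum_a (#|G a| + (d - index a t)))%N.
  by apply: leq_sum => a _; exact: Gc.
rewrite sum_nat_const card_ord big_split /=.
have := sum_subn_index_le d ut ft; move: GXc.
move: (\sum_a _)%N (\sum_i _)%N (m * _)%N (d * _)%N #|` X|%fset => s1 s2 s3 s4 x; lia.
Qed.

(** * Minimal generating sets, extreme points and rank *)

Section Extremal.

Variables (R : realType) (d m : nat) (c : 'I_m -> 'rV[R]_d).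
Local Notation M := (homog_mx c).

(** For [k] in [S]: [c k] is an extreme point of conv [S]. The first homogeneous coordinate forces
    the weights to sum to 1. *)
Definition extremal (S : {set 'I_m}) k := forall l, nonneg_vec l -> supp_in l S ->
  l *m M = homog (c k) -> l = delta_mx 0 k.

(** Take [S] minimal under inclusion. From another representation of [c k], cancelling the weight at
    [k] and rescaling expresses [c k] by the other points, so [k] could be dropped. *)
Lemma minimal_generators : exists S : {set 'I_m},
  (forall a, in_cone M S (homog (c a))) /\ (forall k, k \in S -> extremal S k).
Proof.
pose P (S : {set 'I_m}) := `[< forall a, in_cone M S (homog (c a)) >].
have [|S /minsetP[/asboolP SP Smin] _] := @minset_exists _ P [set: 'I_m]%SET.
  apply/asboolP => a; exists (delta_mx 0 a); split.
  - by move=> i; rewrite mxE.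
  - by move=> i; rewrite inE.
  - by rewrite -rowE row_homog_mx.
exists S; split=> // k kS l l0 lS lM; have l1 := homog_weight lM.
apply: nonneg_weight1 => //; rewrite leNgt; apply/negP => lk.
have lk0 : 0 < 1 - l 0 k by rewrite subr_gt0.
suff /Smin/(_ (subD1set _ _))/setP/(_ k) : P (S :\ k)%SET by rewrite !inE eqxx kS.
pose l' := (1 - l 0 k)^-1 *: (l - l 0 k *: delta_mx 0 k).
have l'M : l' *m M = homog (c k).
  rewrite -scalemxAl mulmxBl lM -scalemxAl -rowE row_homog_mx.
  have -> : homog (c k) - l 0 k *: homog (c k) = (1 - l 0 k) *: homog (c k).
    by rewrite scalerBl scale1r.
  rewrite scalerA mulVf ?scale1r //.
  by rewrite gt_eqF.
have l'k : l' 0 k = 0 by rewrite !mxE !eqxx mulr1 subrr mulr0.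
have l'E i : i != k -> l' 0 i = (1 - l 0 k)^-1 * l 0 i.
  by move=> ik; rewrite !mxE (negPf ik) andbF mulr0 subr0.
have l'0 : nonneg_vec l'.
  move=> i; have [->|/l'E ->] := eqVneq i k; first by rewrite l'k.
  by rewrite mulr_ge0 // invr_ge0 ltW.
have sE (s : R) (v : 'rV_m) j : (s *: v) 0 j = s * v 0 j by rewrite mxE.
apply/asboolP => a; have [r [r0 rS rM]] := SP a.
(* The weight that [r] puts on [k] is redistributed according to [l']. *)
exists (r - r 0 k *: delta_mx 0 k + r 0 k *: l'); split.
- move=> i; rewrite mxE addr_ge0 //; last by rewrite sE mulr_ge0.
  rewrite !mxE eqxx /=; have [->|_] := eqVneq i k; first by rewrite mulr1 subrr.
  by rewrite mulr0 subr0.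
- move=> i; rewrite !inE negb_and negbK => ik.
  rewrite mxE sE; have [->|ne] := eqVneq i k.
    by rewrite l'k mulr0 !mxE !eqxx mulr1 subrr addr0.
  rewrite (negPf ne) /= in ik; rewrite l'E // (lS i) // !mulr0 addr0.
  by rewrite !mxE (rS i) // (negPf ne) andbF mulr0 subr0.
- rewrite mulmxDl mulmxBl -[X in _ + X]scalemxAl l'M -scalemxAl -rowE row_homog_mx rM.
  by rewrite subrK.
Qed.

(** With [X] the rest of [A], this turns the points of [S] into vertices of [A]. *)
Lemma extremal_notin_hull S k (X : set 'rV[R]_d) :
  (forall a, in_cone M S (homog (c a))) -> extremal S k ->
  (forall x, X x -> x != c k /\ exists a, c a = x) ->
  ~ convex_hull X (c k).
Proof.
move=> SP Sk XE /(_ [set x | x != c k /\ in_cone M S (homog x)]%classic).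
(* [conv S] without its extreme point [c k] is still convex. *)
case; last by rewrite eqxx.
split; last by move=> x /XE[xk [a ax]]; split=> //; rewrite -ax.
move=> x y p; rewrite !inE => -[xk [l [l0 lS lM]]] [yk [r [r0 rS rM]]].
set z := conv _ _ _.
pose t : R := p%:inum.
have p0 : 0 <= t := @ge0 R _ p erefl.
have p1 : t <= 1 := @le1 R _ p erefl.
have zE : z = t *: x + (1 - t) *: y by [].
pose u := t *: l + (1 - t) *: r.
have u0 : nonneg_vec u.
  by move=> i; rewrite !mxE addr_ge0 // mulr_ge0 // subr_ge0.
have uS : supp_in u S by move=> i iS; rewrite !mxE lS // rS // !mulr0 addr0.
have uM : u *m M = homog z.
  rewrite mulmxDl -!scalemxAl lM rM zE /homog !scale_row_mx add_row_mx.
  by rewrite -scalerDl addrC subrK scale1r.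
split; last by exists u.
apply/eqP => zk; have := Sk u u0 uS; rewrite uM zk => /(_ erefl) uE.
(* An endpoint of positive weight would have its whole representation at [k] and so equal [c k]. *)
have key s (q : 'rV[R]_m) x' : 0 < s -> x' != c k -> nonneg_vec q -> q *m M = homog x' ->
   (forall i, i != k -> s * q 0 i = 0) -> False.
  move=> s0 /eqP x'k q0 qM qz; apply: x'k.
  have qi i : i != k -> q 0 i = 0.
    by move=> /qz /eqP; rewrite mulf_eq0 gt_eqF //= => /eqP.
  have qE : q = delta_mx 0 k.
    apply: nonneg_weight1 => //; first exact: homog_weight qM.
    rewrite -(homog_weight qM) (bigD1 k) //= big1 ?addr0 //.
  by apply: homog_inj; rewrite -qM qE -rowE row_homog_mx.
have uz i : i != k -> t * l 0 i = 0 /\ (1 - t) * r 0 i = 0.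
  move=> ik; move/rowP/(_ i): uE; rewrite !mxE (negPf ik) andbF.
  by move=> /eqP; rewrite paddr_eq0 ?mulr_ge0 ?subr_ge0 // => /andP[/eqP-> /eqP->].
have [t0|t0] := ltP 0 t.
  by apply: (key t l x) => // i /uz[].
by apply: (key (1 - t) r y) => //; [lra|move=> i /uz[]].
Qed.

(** A smaller rank yields a nonzero [v] orthogonal to all homogenized points, that is, an affine
    equation satisfied by every [c a]. Its linear part must vanish, and then evaluating at one point
    kills the constant term too. *)
Lemma rank_extremal S : (0 < m)%N -> (forall a, in_cone M S (homog (c a))) ->
  (forall u : 'rV[R]_d, u != 0 -> forall b, exists a, \sum_i u 0 i * c a 0 i != b) ->
  \rank (mask_rows M S) = d.+1.
Proof.
move=> m0 SP Hc; apply/eqP; rewrite eqn_leq rank_leq_col /= leqNgt.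
apply/negP => rk.
have MS : (M <= mask_rows M S)%MS.
  by apply/row_subP => a; rewrite row_homog_mx; apply/in_cone_mask_rows/SP.
have {MS}rk : (\rank M < 1 + d)%N by apply: leq_ltn_trans rk; apply: mxrankS.
have /rowV0Pn[v /sub_kermxP vM v0] : kermx M^T != 0.
  by rewrite kermx_eq0 -row_leq_rank mxrank_tr -ltnNge.
have {}vM a : \sum_i rsubmx v 0 i * c a 0 i = - lsubmx v 0 0.
  have : (v *m (homog (c a))^T) 0 0 = 0.
    by rewrite -row_homog_mx rowE trmx_mul mulmxA vM mul0mx mxE.
  rewrite -{1}(hsubmxK v) /homog tr_row_mx mul_row_col mxE trmx1 mulmx1 mxE.
  move=> /eqP; rewrite addrC addr_eq0 => /eqP <-.
  by rewrite [RHS]mxE; apply: eq_bigr => i _; rewrite [X in _ = _ * X]mxE.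
have [u0|u0] := eqVneq (rsubmx v) 0; last first.
  by have [a] := Hc _ u0 (- lsubmx v 0 0); rewrite vM eqxx.
have := vM (Ordinal m0); rewrite u0 big1; last by move=> i _; rewrite mxE mul0r.
move=> /esym/eqP; rewrite oppr_eq0 => /eqP v00.
move: v0; rewrite -(hsubmxK v) u0 [lsubmx v]mx11_scalar v00 raddf0 row_mx0 eqxx.
by [].
Qed.

End Extremal.

(** List a maximal independent set of rows of [S] first, then the rest of [S], then all other
    indices. *)
Lemma basis_order (R : realType) m N (M : 'M[R]_(m, N)) (S : {set 'I_m}) :
  exists t : seq 'I_m, exists n, [/\ uniq t, forall i, i \in t,
    S = prefix_set (index^~ t) n,
    prefix_set (index^~ t) (\rank (mask_rows M S)) \subset S &
    (\rank (mask_rows M S) <=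
       \rank (mask_rows M (prefix_set (index^~ t) (\rank (mask_rows M S)))))%N].
Proof.
set r := \rank (mask_rows M S).
pose f := maxrankfun (mask_rows M S).
pose D : {set 'I_m} := (f @: 'I_r)%SET.
have free := maxrowsub_free (mask_rows M S).
(* Rows outside [S] are masked to zero and cannot occur in a free selection. *)
have fS i : f i \in S.
  apply: contraT => iS.
  have := row_free_inj free.
  move=> /(_ _ (delta_mx 0 i : 'rV_r) 0); rewrite -rowE mul0mx row_rowsub -/f.
  rewrite row_mask_rows (negPf iS) => /(_ erefl)/rowP/(_ i).
  by rewrite !mxE !eqxx => /eqP; rewrite oner_eq0.
have DS : D \subset S by apply/fintype.subsetP => _ /imsetP[i _ ->].
have Dr : #|D| = r.
  by rewrite card_imset ?card_ord //; apply: maxrankfun_inj.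
pose s := enum D ++ enum (S :\: D)%SET.
have sS i : (i \in s) = (i \in S).
  rewrite mem_cat !mem_enum !inE; case: (boolP (i \in D)) => //= iD.
  by rewrite (fintype.subsetP DS).
exists (s ++ enum (~: S)%SET), (size s).
have iD i : i \in D -> (index i (s ++ enum (~: S)%SET) < r)%N.
  move=> iD; rewrite -catA index_cat mem_enum iD -Dr cardE index_mem.
  by rewrite mem_enum.
have Sp : S = prefix_set (index^~ (s ++ enum (~: S)%SET)) (size s).
  apply/setP => i; rewrite mem_prefix_set index_cat sS; case: ifP => iS.
    by rewrite index_mem sS.
  by rewrite ltnNge leq_addr.
split=> //.
- rewrite !cat_uniq !enum_uniq /=; apply/andP; split.
    rewrite andbT; apply/hasPn => i; rewrite !mem_enum !inE => /andP[] //.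
  rewrite andbT; apply/hasPn => i; rewrite mem_enum inE => iS.
  by rewrite sS.
- by move=> i; rewrite mem_cat sS mem_enum inE orbN.
- rewrite {2}Sp; apply/fintype.subsetP => i; rewrite !mem_prefix_set => ir.
  apply: leq_trans ir _; rewrite size_cat -cardE Dr; exact: leq_addr.
apply: leq_trans (_ : \rank (rowsub f (mask_rows M S)) <= _)%N.
  by rewrite (eqP free).
apply: mxrankS; apply/row_subP => i; rewrite row_rowsub row_mask_rows fS.
set p := prefix_set _ _.
have -> : row (f i) M = row (f i) (mask_rows M p).
  by rewrite row_mask_rows mem_prefix_set iD // imset_f.
exact: row_sub.
Qed.

(** * Assembly of the bound for [A] *)

Local Open Scope classical_set_scope.

Theorem theorem1p3 (R : realType) (d : nat) (hd : (1 <= d)%N)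
    (A : {fset 'rV[R]_d}) (m : nat) (hm : #|` A|%fset = m)
    (hA : proper_dimensional [set` A]) :
  m%:R * (d%:R + 1) - d%:R * (d%:R + 1) / 2
    <= (#|` sumset A (vert A)|%fset)%:R :> R.
Proof.
pose c (i : 'I_m) : 'rV[R]_d := nth 0 (enum_fset A) i.
have cA i : c i \in A by rewrite mem_nth // hm.
have c_inj : injective c.
  move=> i j /eqP; rewrite nth_uniq ?fset_uniq ?hm // => /eqP; exact: val_inj.
have A_c x : x \in A -> exists i, c i = x.
  move=> xA; have xm : (index x (enum_fset A) < m)%N by rewrite -hm index_mem.
  by exists (Ordinal xm); rewrite /c nth_index.
have not_in_plane (u : 'rV[R]_d) : u != 0 ->
    forall b, exists a, \sum_i u 0 i * c a 0 i != b.
  move=> u0 b; apply: contrapT => /forallNP H.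
  apply: (hA [set x | \sum_(i < d) u 0 i * x 0 i = b]); first by exists u, b.
  by move=> x /= /A_c[a <-]; apply/eqP/negPn/negP/H.
have m0 : (0 < m)%N.
  (* An empty [A] would lie in the hyperplane with the all-ones normal, which is nonzero as d is
     positive. *)
  case: (posnP m) => // m0; have u0 : const_mx 1 != 0 :> 'rV[R]_d.
    apply/eqP => /rowP/(_ (Ordinal hd)); rewrite !mxE => /eqP.
    by rewrite oner_eq0.
  by have [a _] := not_in_plane _ u0 0; have := ltn_ord a; rewrite [X in (_ < X)%N]m0.
have [S [Scone Sext]] := minimal_generators c.
have rS := rank_extremal m0 Scone not_in_plane.
have [t [n [ut ft SE dS rd]]] := basis_order (homog_mx c) S.
rewrite rS in dS rd; rewrite SE in Scone Sext dS.
have index_inj : injective (index^~ t).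
  by move=> i j e; rewrite -(nth_index i (ft i)) e nth_index.
have [G [GS Ginj Gc]] := star_system c_inj index_inj Scone Sext rd dS.
have GX a i : i \in G a -> c a + c i \in sumset A (vert A).
  move=> /(fintype.subsetP (GS a)) iS; apply/imfset2P; exists (c a) => //=.
  exists (c i) => //=; rewrite !inE cA /=; apply/negP; rewrite inE.
  apply: (extremal_notin_hull Scone (Sext i iS)) => x [/= /A_c[b <-] /eqP bi].
  by split=> //; exists b.
have := card_star_sums ut ft Ginj Gc GX.
move: #|` sumset A (vert A)|%fset => x.
rewrite -(ler_nat R) natrD !natrM -[d.+1]addn1 natrD => H.
by lra.
Qed.
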